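(* Let $(A^+,\mathfrak{p})$ be a semi-valuation ring with non-trivial valuation. If the semi-fraction ring $A=A^+_{\mathfrak{p}}$ is coherent and not regular, then the ring $A^+$ is not coherent.
   Context: All rings are commutative with unit. A valuation on a ring $R$ is a map $|-|\colon R\to\Gamma\cup\{0\}$, with $\Gamma$ a totally ordered multiplicative abelian group, such that $|0|=0$, $|1|=1$, $|xy|=|x||y|$, $|x+y|\le\max\{|x|,|y|\}$ (conventions $0\cdot\gamma=0$, $0<\gamma$ for $\gamma\in\Gamma$); its support is the prime ideal $|-|^{-1}(0)$. A semi-valuation ring is a ring $A^+$ with a valuation $|-|$ such that (1) every zero divisor of $A^+$ lies in the support of $|-|$ and (2) for all $x,y\in A^+$ with $|x|\le|y|\ne 0$ one has $y\mid x$ in $A^+$. One writes it as $(A^+,\mathfrak{p})$ where $\mathfrak{p}$ is the support of $|-|$; then $V=A^+/\mathfrak{p}$ is a valuation ring, and the valuation is called non-trivial if $V$ is not a field. A ring is coherent if every finitely generated ideal is finitely presented. A module is pseudo-coherent if it has a resolution (possibly infinite) by finitely generated projective modules; a ring is regular if every pseudo-coherent module over it has finite projective dimension. *)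

(* Defs.v *)
From HB Require Import structures.
From mathcomp Require Import all_boot all_order all_algebra.
From mathcomp Require Import generic_quotient ring_quotient ring boolp.

Set Implicit Arguments.
Unset Strict Implicit.
Unset Printing Implicit Defensive.

Import GRing.Theory.
Local Open Scope ring_scope.
Local Open Scope quotient_scope.

Section Modules.
Variable R : comPzRingType.

Definition epi (M N : lmodType R) (f : {linear M -> N}) : Prop :=
  forall y, exists x, f x = y.

Definition exact (M N K : lmodType R)
    (f : {linear M -> N}) (g : {linear N -> K}) : Prop :=
  forall y, g y = 0 <-> exists x, f x = y.

Definition fin_gen (M : lmodType R) : Prop :=
  exists n (g : {linear 'rV[R]_n -> M}), epi g.

Definition fin_pres (M : lmodType R) : Prop :=
  exists m n (f : {linear 'rV[R]_m -> 'rV[R]_n}) (g : {linear 'rV[R]_n -> M}),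
    exact f g /\ epi g.

Definition projective (P : lmodType R) : Prop :=
  forall (M N : lmodType R) (g : {linear M -> N}) (h : {linear P -> N}),
    epi g -> exists k : {linear P -> M}, forall x, g (k x) = h x.

(* ... -> P 2 -> P 1 -> P 0 -> M -> 0, with d i : P i.+1 -> P i. *)
Definition resolution (M : lmodType R) (P : nat -> lmodType R)
    (d : forall i, {linear P i.+1 -> P i}) (e : {linear P 0%N -> M}) : Prop :=
  [/\ epi e, exact (d 0%N) e & forall i, exact (d i.+1) (d i)].

Definition pseudo_coherent (M : lmodType R) : Prop :=
  exists (P : nat -> lmodType R) (d : forall i, {linear P i.+1 -> P i})
         (e : {linear P 0%N -> M}),
    resolution d e /\ forall i, fin_gen (P i) /\ projective (P i).

Definition finite_proj_dim (M : lmodType R) : Prop :=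
  exists (P : nat -> lmodType R) (d : forall i, {linear P i.+1 -> P i})
         (e : {linear P 0%N -> M}) (n : nat),
    [/\ resolution d e, forall i, projective (P i)
      & forall i, (n < i)%N -> forall x : P i, x = 0].

End Modules.

Section Submodule.
Variables (R : pzRingType) (V : lmodType R) (S : submodClosed V).

Record submod : Type := Submod { submod_val : V; _ : submod_val \in S }.

HB.instance Definition _ := [isSub for submod_val].
HB.instance Definition _ := [Choice of submod by <:].
HB.instance Definition _ := [SubChoice_isSubLmodule of submod by <:].
End Submodule.

(* The ideals of R are the submodules of the regular module R^o. *)
Definition coherent (R : comPzRingType) : Prop :=
  forall I : submodClosed R^o, fin_gen (submod I) -> fin_pres (submod I).

Definition regular (R : comPzRingType) : Prop :=
  forall M : lmodType R, pseudo_coherent M -> finite_proj_dim M.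

Definition is_field (R : comPzRingType) : Prop :=
  (1 : R) <> 0 /\ forall x : R, x <> 0 -> exists y, x * y = 1.

Section Localization.
Variables (R : comNzRingType) (I : prime_idealr R).

Definition denom : Type := {s : R | s \notin I}.
HB.instance Definition _ := Choice.on denom.

Definition dval (s : denom) : R := sval s.

Lemma dvalP s : dval s \notin I.
Proof. by case: s. Qed.

Lemma denom1_subproof : (1 : R) \notin I.
Proof. by rewrite idealr1. Qed.

Definition denom1 : denom :=
  exist (fun s : R => s \notin I) 1 denom1_subproof.

Lemma dval_denom1 : dval denom1 = 1.
Proof. by []. Qed.

Lemma denomM_subproof (s t : denom) : dval s * dval t \notin I.
Proof. by rewrite prime_idealrM negb_or (dvalP s) (dvalP t). Qed.

Definition denomM (s t : denom) : denom :=
  exist (fun s : R => s \notin I) _ (denomM_subproof s t).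

Lemma dval_denomM s t : dval (denomM s t) = dval s * dval t.
Proof. by []. Qed.

Definition preloc : Type := R * denom.
HB.instance Definition _ := Choice.on preloc.
Implicit Types x y z : preloc.

Definition locfrac_eq x y : bool :=
  `[< exists t : denom, dval t * (x.1 * dval y.2 - y.1 * dval x.2) = 0 >].

Lemma locfrac_eq_equiv : equiv_class_of locfrac_eq.
Proof.
split=> [x|x y|y x z].
- by apply/asboolP; exists denom1; rewrite subrr mulr0.
- by apply/asboolP/asboolP => -[t h]; exists t; rewrite -opprB mulrN h oppr0.
move=> /asboolP[t ht] /asboolP[u hu]; apply/asboolP.
exists (denomM (denomM t u) y.2); rewrite !dval_denomM.
transitivity (dval u * dval z.2 * (dval t * (x.1 * dval y.2 - y.1 * dval x.2))
    + dval t * dval x.2 * (dval u * (y.1 * dval z.2 - z.1 * dval y.2))).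
  by ring.
by rewrite ht hu !mulr0 addr0.
Qed.

Canonical locfrac_eq_equivRel := EquivRelPack locfrac_eq_equiv.
Canonical locfrac_eq_encModRel := defaultEncModRel locfrac_eq.

Definition localization : Type := {eq_quot locfrac_eq}.
HB.instance Definition _ : EqQuotient preloc locfrac_eq localization :=
  EqQuotient.on localization.
HB.instance Definition _ := Choice.on localization.

Definition locfrac (a : R) (s : denom) : localization := \pi_localization (a, s).

Lemma locfracP (a b : R) (s t : denom) :
  locfrac a s = locfrac b t <->
  exists u : denom, dval u * (a * dval t - b * dval s) = 0.
Proof.
split=> [/eqP|h]; first by rewrite /locfrac pi_eq_quot => /asboolP.
by apply/eqP; rewrite /locfrac pi_eq_quot; apply/asboolP.
Qed.

Lemma locfrac_ind (P : localization -> Prop) :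
  (forall a s, P (locfrac a s)) -> forall x : localization, P x.
Proof. by move=> h x; rewrite -[x]reprK; case: (repr x). Qed.

Definition loc_add (x y : localization) : localization :=
  let: (a, s) := repr x in let: (b, t) := repr y in
  locfrac (a * dval t + b * dval s) (denomM s t).

Definition loc_opp (x : localization) : localization :=
  let: (a, s) := repr x in locfrac (- a) s.

Definition loc_mul (x y : localization) : localization :=
  let: (a, s) := repr x in let: (b, t) := repr y in
  locfrac (a * b) (denomM s t).

Lemma locfrac_repr a s : locfrac (repr (locfrac a s)).1 (repr (locfrac a s)).2 = locfrac a s.
Proof. by rewrite {1}/locfrac -surjective_pairing reprK. Qed.

Lemma loc_addE a s b t :
  loc_add (locfrac a s) (locfrac b t) = locfrac (a * dval t + b * dval s) (denomM s t).
Proof.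
rewrite /loc_add; have := locfrac_repr b t; have := locfrac_repr a s.
case: (repr (locfrac a s)) (repr (locfrac b t)) => [a' s'] [b' t'] /=.
move=> /locfracP[u hu] /locfracP[w hw]; apply/locfracP; exists (denomM u w).
rewrite !dval_denomM.
transitivity (dval w * dval t * dval t' * (dval u * (a' * dval s - a * dval s'))
  + dval u * dval s * dval s' * (dval w * (b' * dval t - b * dval t'))).
  by ring.
by rewrite hu hw !mulr0 addr0.
Qed.

Lemma loc_oppE a s : loc_opp (locfrac a s) = locfrac (- a) s.
Proof.
rewrite /loc_opp; have := locfrac_repr a s.
case: (repr (locfrac a s)) => [a' s'] /= /locfracP[u hu]; apply/locfracP; exists u.
by rewrite !mulNr -opprD mulrN hu oppr0.
Qed.

Lemma loc_mulE a s b t :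
  loc_mul (locfrac a s) (locfrac b t) = locfrac (a * b) (denomM s t).
Proof.
rewrite /loc_mul; have := locfrac_repr b t; have := locfrac_repr a s.
case: (repr (locfrac a s)) (repr (locfrac b t)) => [a' s'] [b' t'] /=.
move=> /locfracP[u hu] /locfracP[w hw]; apply/locfracP; exists (denomM u w).
rewrite !dval_denomM.
transitivity (dval w * b' * dval t * (dval u * (a' * dval s - a * dval s'))
  + dval u * a * dval s' * (dval w * (b' * dval t - b * dval t'))).
  by ring.
by rewrite hu hw !mulr0 addr0.
Qed.

Lemma locfrac_congr a s b t : a * dval t = b * dval s -> locfrac a s = locfrac b t.
Proof. by move=> h; apply/locfracP; exists denom1; rewrite h subrr mulr0. Qed.

Lemma loc_addA : associative loc_add.
Proof.
elim/locfrac_ind=> a s; elim/locfrac_ind=> b t; elim/locfrac_ind=> c u.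
by rewrite !loc_addE; apply: locfrac_congr; rewrite !dval_denomM; ring.
Qed.

Lemma loc_addC : commutative loc_add.
Proof.
elim/locfrac_ind=> a s; elim/locfrac_ind=> b t.
by rewrite !loc_addE; apply: locfrac_congr; rewrite !dval_denomM; ring.
Qed.

Lemma loc_add0 : left_id (locfrac 0 denom1) loc_add.
Proof.
elim/locfrac_ind=> a s; rewrite loc_addE; apply: locfrac_congr.
by rewrite dval_denomM dval_denom1; ring.
Qed.

Lemma loc_addN : left_inverse (locfrac 0 denom1) loc_opp loc_add.
Proof.
elim/locfrac_ind=> a s; rewrite loc_oppE loc_addE; apply: locfrac_congr.
by rewrite dval_denomM dval_denom1; ring.
Qed.

HB.instance Definition _ :=
  GRing.isZmodule.Build localization loc_addA loc_addC loc_add0 loc_addN.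

Lemma loc_mulA : associative loc_mul.
Proof.
elim/locfrac_ind=> a s; elim/locfrac_ind=> b t; elim/locfrac_ind=> c u.
by rewrite !loc_mulE; apply: locfrac_congr; rewrite !dval_denomM; ring.
Qed.

Lemma loc_mulC : commutative loc_mul.
Proof.
elim/locfrac_ind=> a s; elim/locfrac_ind=> b t.
by rewrite !loc_mulE; apply: locfrac_congr; rewrite !dval_denomM; ring.
Qed.

Lemma loc_mul1 : left_id (locfrac 1 denom1) loc_mul.
Proof.
elim/locfrac_ind=> a s; rewrite loc_mulE; apply: locfrac_congr.
by rewrite dval_denomM dval_denom1; ring.
Qed.

Lemma loc_mulDl : left_distributive loc_mul loc_add.
Proof.
elim/locfrac_ind=> a s; elim/locfrac_ind=> b t; elim/locfrac_ind=> c u.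
rewrite !(loc_addE, loc_mulE); apply: locfrac_congr.
by rewrite !dval_denomM; ring.
Qed.

Lemma loc_oner_neq0 : locfrac 1 denom1 != 0.
Proof.
apply/eqP => /locfracP[u]; rewrite dval_denom1 mul0r subr0 !mulr1 => u0.
by have := dvalP u; rewrite u0 rpred0.
Qed.

HB.instance Definition _ := GRing.Zmodule_isComNzRing.Build localization
  loc_mulA loc_mulC loc_mul1 loc_mulDl loc_oner_neq0.

Lemma locfracD a s b t :
  locfrac a s + locfrac b t = locfrac (a * dval t + b * dval s) (denomM s t).
Proof. exact: loc_addE. Qed.

Lemma locfracM a s b t : locfrac a s * locfrac b t = locfrac (a * b) (denomM s t).
Proof. exact: loc_mulE. Qed.

End Localization.

HB.mixin Record Group_isOrderedAbelian (d : Order.disp_t) (G : Type)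
    of Group G & Order.Total d G := {
  ogrp_mulC : forall x y : G, (x * y)%g = (y * x)%g;
  ogrp_le_mul2l : forall z x y : G, (x <= y)%O -> (z * x <= z * y)%O%g
}.

#[short(type="orderedAbGroupType")]
HB.structure Definition OrderedAbGroup (d : Order.disp_t) :=
  { G of Group G & Order.Total d G & Group_isOrderedAbelian d G }.

(* [option Gamma] is Gamma with a zero adjoined: [None] is the zero. *)
Section ValueMonoid.
Variables (d : Order.disp_t) (Gamma : orderedAbGroupType d).
Implicit Types a b : option Gamma.

Definition vmul a b : option Gamma :=
  if a is Some x then if b is Some y then Some (x * y)%g else None else None.

Definition vle a b : bool :=
  if a is Some x then if b is Some y then (x <= y)%O else false else true.

Definition vmax a b : option Gamma := if vle a b then b else a.

End ValueMonoid.

Record valuation (R : comNzRingType) (d : Order.disp_t)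
    (Gamma : orderedAbGroupType d) : Type := Valuation {
  val_fun :> R -> option Gamma;
  val_fun0 : val_fun 0 = None;
  val_fun1 : val_fun 1 = Some 1%g;
  val_funM : forall x y, val_fun (x * y) = vmul (val_fun x) (val_fun y);
  val_funD : forall x y, vle (val_fun (x + y)) (vmax (val_fun x) (val_fun y))
}.

Section SemiValuation.
Variables (R : comNzRingType) (d : Order.disp_t).
Variables (Gamma : orderedAbGroupType d) (v : valuation R Gamma).

Definition vsupport : R -> bool := fun x => v x == None.

Lemma vsupport_idealr_closed : idealr_closed vsupport.
Proof.
split; rewrite ?unfold_in /= /vsupport ?val_fun0 ?val_fun1 // => a x y.
rewrite !unfold_in => /eqP x0 /eqP y0; have := val_funD v (a * x) y.
by rewrite val_funM x0 y0; case: (v a) => [?|]; case: (v _).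
Qed.

Lemma vsupport_prime_closed : prime_idealr_closed vsupport.
Proof.
move=> x y; rewrite !unfold_in /= /vsupport val_funM.
by case: (v x); case: (v y).
Qed.

HB.instance Definition _ := isIdealr.Build R vsupport vsupport_idealr_closed.
HB.instance Definition _ :=
  isPrimeIdealrClosed.Build R vsupport vsupport_prime_closed.

Definition vsupport_ideal : prime_idealr R := vsupport.

Definition zero_divisor (x : R) : Prop := exists2 y, y <> 0 & x * y = 0.

Definition divides (y x : R) : Prop := exists z, x = y * z.

Definition semi_valuation : Prop :=
  (forall x, zero_divisor x -> x \in vsupport) /\
  (forall x y, vle (v x) (v y) -> v y <> None -> divides y x).

Definition nontrivial : Prop := ~ is_field {ideal_quot vsupport_ideal}.

Definition semi_fraction_ring : comNzRingType := localization vsupport_ideal.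

End SemiValuation.

(* Main.v *)
Require Import Defs.
From mathcomp Require Import all_boot all_order all_algebra.
From HB Require Import structures.
From mathcomp Require Import generic_quotient ring_quotient ring boolp.

(** Write p for the support of the valuation and A for the localization of
    A+ at p. Suppose that A+ is coherent; then A turns out to be a valuation
    domain, hence regular, which contradicts the assumption on A.

    The engine is Nakayama's lemma. The valuation being non-trivial, some s
    outside p is not a unit. Such an s divides every element of p and is not a
    zero divisor, so if a system x_1, ..., x_n in A+ has only linear relations
    with all coefficients in p, every relation is s times another relation: the
    module K of relations satisfies K = sK. Coherence makes K finitely
    generated, and A+ is local, so K = 0 ([relations_trivial]).

    For n = 1, a relation of a nonzero x has its coefficient in p, because zero
    divisors lie in p. Hence x has no nonzero annihilator: A+ is a domain
    ([semi_valuation_integral]). For n = 2, a relation between x and y with a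
    coefficient outside p says that one of x, y divides the other in A; if
    there is none, the Koszul relation (y, -x) must vanish, and x = y = 0
    ([fraction_comparable]). So A is a domain in which divisibility is total.

    Over such a ring, a finitely generated torsion-free module is projective: a
    nontrivial relation among generators can be divided by a coefficient that
    divides all the others, after which one generator is redundant
    ([torsion_free_projective]). Given a pseudo-coherent M, this applies to the
    kernel of P_0 -> M, a finitely generated submodule of a projective module;
    so M has projective dimension at most 1 ([valuation_domain_regular]). *)

Set Implicit Arguments.
Unset Strict Implicit.
Unset Printing Implicit Defensive.

Import GRing.Theory.
Local Open Scope ring_scope.
Local Open Scope quotient_scope.

(** * Linear maps, kernels and images *)

Section LinearMaps.
Variable R : comPzRingType.

(** Bundles a function whose linearity is only known inside a proof, where no
    canonical instance can be declared. *)
Definition linear_pack (M N : lmodType R) (f : M -> N) (hf : linear f) :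
  {linear M -> N} := HB.pack f (GRing.isLinear.Build R M N *:%R f hf).

Section LinComb.
Variables (M : lmodType R) (n : nat) (m : 'I_n -> M).

Definition lincomb_fun (u : 'rV[R]_n) : M := \sum_i u 0 i *: m i.

Lemma lincomb_linear : linear lincomb_fun.
Proof.
move=> a u w; rewrite /lincomb_fun scaler_sumr -big_split.
by apply: eq_bigr => i _; rewrite !mxE scalerDl scalerA.
Qed.

Definition lincomb : {linear 'rV[R]_n -> M} := linear_pack lincomb_linear.

Lemma lincombE u : lincomb u = \sum_i u 0 i *: m i.
Proof. by []. Qed.

End LinComb.

Lemma linear_rVE (M : lmodType R) n (g : {linear 'rV[R]_n -> M}) u :
  g u = \sum_i u 0 i *: g (delta_mx 0 i).
Proof.
rewrite {1}[u]row_sum_delta linear_sum.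
by apply: eq_bigr => i _; rewrite linearZ.
Qed.

Lemma rV_projective n : projective 'rV[R]_n.
Proof.
move=> M N g h epi_g.
have [m gm] := choice (fun i => epi_g (h (delta_mx 0 i))).
exists (lincomb m) => u; rewrite lincombE linear_sum [h u]linear_rVE.
by apply: eq_bigr => i _; rewrite linearZ gm.
Qed.

(** A bijective linear map has a linear inverse. *)
Lemma projective_iso (P Q : lmodType R) (f : {linear P -> Q}) :
  projective P -> epi f -> (forall x, f x = 0 -> x = 0) -> projective Q.
Proof.
move=> projP epi_f inj_f M N g h epi_g.
have [s fs] := choice epi_f.
have lin_s : linear s.
  move=> a x y; apply/eqP; rewrite -subr_eq0; apply/eqP/inj_f.
  by rewrite linearB linearP /= !fs subrr.
have [k hk] := projP M N g (h \o f) epi_g.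
by exists (k \o linear_pack lin_s) => y /=; rewrite hk /= fs.
Qed.

Section Kernel.
Variables (M N : lmodType R) (f : {linear M -> N}).

Definition ker_pred : {pred M} := fun x => f x == 0.

Lemma ker_submod_closed : submod_closed ker_pred.
Proof.
split; rewrite ?unfold_in ?linear0 // => a x y.
rewrite !unfold_in => /eqP fx /eqP fy.
by rewrite linearP /= fx fy scaler0 addr0.
Qed.

HB.instance Definition _ :=
  GRing.isSubmodClosed.Build R M ker_pred ker_submod_closed.

Definition ker : submodClosed M := ker_pred.

End Kernel.

Section Image.
Variables (M N : lmodType R) (f : {linear M -> N}).

Definition im_pred : {pred N} := fun y => `[< exists x, f x = y >].

Lemma im_submod_closed : submod_closed im_pred.
Proof.
split; rewrite ?unfold_in; first by apply/asboolP; exists 0; rewrite linear0.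
move=> a x y; rewrite !unfold_in => /asboolP[x' <-] /asboolP[y' <-].
by apply/asboolP; exists (a *: x' + y'); rewrite linearP.
Qed.

HB.instance Definition _ :=
  GRing.isSubmodClosed.Build R N im_pred im_submod_closed.

Definition im : submodClosed N := im_pred.

End Image.

Section Submodules.
Variables (N : lmodType R) (S : submodClosed N).

Lemma submod_val_linear : linear (@submod_val R N S).
Proof. by []. Qed.

Definition incl : {linear submod S -> N} := linear_pack submod_val_linear.

Lemma incl_mem x : incl x \in S.
Proof. by case: x. Qed.

Lemma incl_inj x : incl x = 0 -> x = 0.
Proof. by move=> h; apply: val_inj. Qed.

Lemma incl_onto y : y \in S -> exists x, incl x = y.
Proof. by move=> yS; exists (Submod yS). Qed.

Variables (M : lmodType R) (f : {linear M -> N}) (fS : forall x, f x \in S).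

Lemma corestrict_linear : linear (fun x => Submod (fS x)).
Proof. by move=> a x y; apply: val_inj; rewrite /= linearP. Qed.

Definition corestrict : {linear M -> submod S} := linear_pack corestrict_linear.

Lemma corestrictE x : incl (corestrict x) = f x.
Proof. by []. Qed.

End Submodules.

(** * Resolutions of length one *)

Section TwoTerm.
Variables (P0 P1 : lmodType R) (f : {linear P1 -> P0}).

Definition two_term (i : nat) : lmodType R :=
  match i with 0 => P0 | 1 => P1 | _ => 'rV[R]_0 end.

Definition two_term_diff (i : nat) :
    {linear two_term i.+1 -> two_term i} :=
  match i with 0 => f | _ => \0 end.

Lemma two_term_finite_proj_dim (M : lmodType R) (e : {linear P0 -> M}) :
  projective P0 -> projective P1 -> epi e -> exact f e ->
  (forall x, f x = 0 -> x = 0) -> finite_proj_dim M.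
Proof.
move=> proj0 proj1 epi_e ex_e inj_f.
exists two_term, two_term_diff, e, 1%N; split.
- split=> // -[|i] y /=; last first.
    split=> // _; exists 0; by rewrite [y]thinmx0.
  split=> [/inj_f ->|[x <-]]; last by rewrite linear0.
  by exists 0.
- by case=> [|[|i]] //; apply: rV_projective.
- by case=> [|[|i]] // _ x; rewrite [x]thinmx0.
Qed.

End TwoTerm.

(** * Coherence and modules of relations *)

(** The Schanuel argument: finite presentation does not depend on the chosen
    generators. Compare g with a given presentation f0, g0 by lifts al and be of
    g0 along g and of g along g0. For z in the kernel of g, the element be z is
    in the image of f0, and z = al (be z) + (z - al (be z)); so the kernel of g
    is generated by the image of al \o f0 and by that of id - al \o be. *)
Lemma fin_pres_kernel n (M : lmodType R) (g : {linear 'rV[R]_n -> M}) :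
  fin_pres M -> epi g ->
  exists k (h : {linear 'rV[R]_k -> 'rV[R]_n}), exact h g.
Proof.
move=> [m [l [f0 [g0 [ex0 epi0]]]]] epi_g.
have [al gal] := rV_projective g0 epi_g.
have [be gbe] := rV_projective g epi0.
pose h (u : 'rV[R]_(m + n)) :=
  al (f0 (lsubmx u)) + (rsubmx u - al (be (rsubmx u))).
have lin_h : linear h.
  move=> a u w; rewrite /h !linearP /= !scalerDr.
  by rewrite [X in _ + X = _]addrACA [LHS]addrACA.
exists (m + n)%N, (linear_pack lin_h) => z; split=> [gz|[u <-]] /=.
  have /ex0[w fw] : g0 (be z) = 0 by rewrite gbe.
  exists (row_mx w z).
  by rewrite /= /h row_mxKl row_mxKr fw addrC subrK.
rewrite /h linearD linearB /= !gal gbe subrr addr0.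
by apply/ex0; exists (lsubmx u).
Qed.

(** The relations between the x i form the kernel of the map from R^n onto the
    ideal that the x i generate. *)
Lemma coherent_relations n (x : 'I_n -> R) :
  coherent R ->
  exists k (h : {linear 'rV[R]_k -> 'rV[R]_n}),
    forall z : 'rV[R]_n, \sum_i z 0 i * x i = 0 <-> exists w, h w = z.
Proof.
move=> cohR; pose f : {linear 'rV[R]_n -> R^o} := @lincomb R^o n x.
have fS u : f u \in im f by rewrite unfold_in; apply/asboolP; exists u.
have epi_f : epi (corestrict fS).
  move=> y; have := incl_mem y; rewrite unfold_in => /asboolP[u fu].
  by exists u; apply: val_inj; rewrite -fu.
have [|k [h ex_h]] := fin_pres_kernel (cohR (im f) _) epi_f.
  by exists n, (corestrict fS).
exists k, h => z; split=> [z0|/ex_h/(congr1 val) //].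
by apply/ex_h; apply: val_inj.
Qed.

End LinearMaps.

(** * Nakayama's lemma *)

Section Nakayama.
Variable R : comNzRingType.

(** Evaluate at s the polynomial det (1 - X U), whose constant coefficient is
    det 1 = 1. *)
Lemma det_1_sub_scale n (s : R) (U : 'M[R]_n) :
  exists c, \det (1%:M - s *: U) = 1 + s * c.
Proof.
pose p := \det (1%:M - 'X *: map_mx polyC U).
have ev a : p.[a] = \det (1%:M - a *: U).
  rewrite -horner_evalE /p -det_map_mx; congr (\det _).
  apply/matrixP => i j; rewrite !mxE /= horner_evalE.
  by rewrite !hornerE hornerMn hornerC.
have [q] : exists q, p = q * 'X + 1.
  exists (drop_poly 1 p); rewrite -{1}[p](poly_take_drop 1) addrC expr1.
  congr (_ + _); rewrite -[1]/(1%:P); apply/polyP => i.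
  rewrite coef_take_poly coefC; case: i => //=.
  by rewrite -horner_coef0 ev scale0r subr0 det1.
move=> pE; exists q.[s]; rewrite -ev pE !hornerE.
by rewrite addrC mulrC.
Qed.

(** The determinant trick. The first hypothesis says that s lies in the Jacobson
    radical. Dividing the generators by s yields a matrix U for which 1 - s U
    annihilates them; then so does its determinant, which is invertible. *)
Lemma nakayama (s : R) (M : lmodType R) :
  (forall c, exists e, e * (1 + s * c) = 1) -> fin_gen M ->
  (forall x : M, exists y, x = s *: y) -> forall x : M, x = 0.
Proof.
move=> radical_s [n [g epi_g]] divM.
have /choice[u gu] i : exists w, g (delta_mx 0 i) = s *: g w.
  have [y ->] := divM (g (delta_mx 0 i)).
  by have [w <-] := epi_g y; exists w.
pose U := \matrix_i u i.
have gU w : g (w *m (1%:M - s *: U)) = 0.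
  rewrite mulmxBr mulmx1 -scalemxAr linearB linearZ /=.
  rewrite mulmx_sum_row linear_sum [g w]linear_rVE scaler_sumr -sumrB.
  apply: big1 => i _; rewrite rowK linearZ gu /=.
  by rewrite scalerN [g (_ *: _)]linearZ /= !scalerA mulrC subrr.
move=> x; have [w <-] := epi_g x.
have [c dc] := det_1_sub_scale s U; have [e he] := radical_s c.
have := gU (w *m \adj (1%:M - s *: U)).
rewrite -mulmxA mul_adj_mx dc mul_mx_scalar linearZ /= => h0.
by rewrite -[g w]scale1r -he -scalerA h0 scaler0.
Qed.

End Nakayama.

(** * Regularity of valuation domains *)

Section ValuationDomain.
Variable R : comNzRingType.

Definition integral : Prop := forall a b : R, a * b = 0 -> a = 0 \/ b = 0.

Definition total_divides : Prop := forall a b : R, divides a b \/ divides b a.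

Lemma common_divisor n (u : 'I_n.+1 -> R) :
  total_divides -> exists i, forall j, divides (u i) (u j).
Proof.
move=> tot; elim: n u => [|n IH] u.
  by exists ord0 => j; exists 1; rewrite mulr1 [j]ord1 [ord0]ord1.
have [i ui] := IH (fun j => u (lift ord0 j)).
have [[c uc]|[c uc]] := tot (u ord0) (u (lift ord0 i)).
  exists ord0 => j; have [j' ->|->] := unliftP ord0 j.
    by have [e ->] := ui j'; exists (c * e); rewrite uc mulrA.
  by exists 1; rewrite mulr1.
exists (lift ord0 i) => j; have [j' ->|->] := unliftP ord0 j; first exact: ui.
by exists c.
Qed.

Definition torsion_free (M : lmodType R) : Prop :=
  forall (a : R) (x : M), a *: x = 0 -> a = 0 \/ x = 0.

(** Induction on the number of generators. If they satisfy a nontrivial relation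
    u, divide u by the coefficient u_i that divides all the others: as K is
    torsion-free, the quotient w is again a relation, and w_i = 1 expresses the
    i-th generator through the remaining ones. *)
Lemma torsion_free_projective (K : lmodType R) :
  integral -> total_divides -> fin_gen K -> torsion_free K -> projective K.
Proof.
move=> domR tot [n [g epi_g]] tfK; elim: n g epi_g => [|n IH] g epi_g.
  by apply: projective_iso (@rV_projective R 0) epi_g _ => x _; exact: thinmx0.
have [inj_g|] := pselect (forall x, g x = 0 -> x = 0).
  exact: projective_iso (@rV_projective R n.+1) epi_g inj_g.
move=> /existsNP[u /not_implyP[gu u_neq0]].
have [i /choice[c uc]] := common_divisor (fun j => u 0 j) tot.
pose w : 'rV[R]_n.+1 := \row_j c j.
have uE : u = u 0 i *: w by apply/rowP => j; rewrite !mxE -uc.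
have ui_neq0 : u 0 i <> 0 by move=> h; apply: u_neq0; rewrite uE h scale0r.
have gw : g w = 0 by case: (tfK (u 0 i) (g w)) => //; rewrite -linearZ -uE.
have ci : c i = 1.
  apply/esym/eqP; rewrite -subr_eq0; apply/eqP.
  by case: (domR (u 0 i) (1 - c i)) => //; rewrite mulrBr mulr1 -uc subrr.
apply: (IH (lincomb (fun j => g (delta_mx 0 (lift i j))))) => y.
(* Modulo the relation w, the i-th coordinate of any preimage can be cleared. *)
have [x gx] := epi_g y; pose x' := x - x 0 i *: w.
exists (\row_j x' 0 (lift i j)).
have <- : g x' = y by rewrite linearB linearZ /= gw scaler0 subr0.
rewrite lincombE [RHS]linear_rVE [RHS](bigD1_ord i) //=.
rewrite {2}/x' !mxE ci mulr1 subrr scale0r add0r.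
by apply: eq_bigr => j _; rewrite mxE.
Qed.

(** A projective quotient of R^n embeds into R^n, by a section. *)
Lemma projective_torsion_free (P : lmodType R) :
  integral -> fin_gen P -> projective P -> torsion_free P.
Proof.
move=> domR [n [g epi_g]] projP a x ax0.
have [k gk] := projP _ _ g idfun epi_g.
have [->|a_neq0] := pselect (a = 0); [by left | right].
have kx : k x = 0.
  apply/rowP => j; have := congr1 (fun y => k y 0 j) ax0.
  by rewrite linearZ linear0 !mxE => /domR[].
by rewrite -[x]gk kx linear0.
Qed.

(** The kernel of P_0 -> M is the image of P_1, hence finitely generated, and it
    is torsion-free as a submodule of P_0. *)
Lemma valuation_domain_regular : integral -> total_divides -> regular R.
Proof.
move=> domR tot M [P [d [e [[epi_e ex0 _] fgP]]]].
have [fg0 proj0] := fgP 0%N; have [[n [g epi_g]] _] := fgP 1%N.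
have dS x : d 0%N x \in ker e.
  by rewrite unfold_in; apply/eqP/ex0; exists x.
apply: (two_term_finite_proj_dim (f := incl (ker e)) proj0 _ epi_e) _ => [|y|].
- apply: torsion_free_projective => //; last first.
    move=> a x ax0.
    case: (projective_torsion_free domR fg0 proj0 (a := a) (x := incl _ x)).
    + by rewrite -linearZ ax0 linear0.
    + by left.
    by move=> /incl_inj; right.
  exists n, (corestrict dS \o g) => y.
  have := incl_mem y; rewrite unfold_in => /eqP/ex0[x dx].
  have [w gw] := epi_g x; exists w; apply: val_inj.
  by rewrite /= gw dx.
- split=> [ey|[x <-]].
    by apply: incl_onto; rewrite unfold_in; apply/eqP.
  by apply/eqP; have := incl_mem x; rewrite unfold_in.
- exact: incl_inj.
Qed.

End ValuationDomain.

(** * Semi-valuation rings *)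

Section SemiValuationRing.
Variables (R : comNzRingType) (d : Order.disp_t).
Variables (Gamma : orderedAbGroupType d) (v : valuation R Gamma).
Hypothesis semi_v : semi_valuation v.

Local Notation p := (vsupport v).

(** Compare the values of a and b. The larger value is nonzero since one of the
    two is, so the divisibility axiom of semi-valuation rings applies. *)
Lemma divides_total a b : a \notin p \/ b \notin p -> divides a b \/ divides b a.
Proof.
have [_ div_v] := semi_v => ab.
have le_v : vle (v a) (v b) || vle (v b) (v a).
  by case: (v a) (v b) => [x|] [y|] //=; apply: Order.TotalTheory.le_total.
have nz x : x \notin p -> v x <> None by rewrite unfold_in => /eqP.
have vle0 x y : x \notin p -> vle (v x) (v y) -> y \notin p.
  rewrite !unfold_in /vsupport; by case: (v x) (v y) => [?|] [?|].
case/orP: le_v => h.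
  right; apply: div_v => //; apply: nz.
  by case: ab => // /vle0 /(_ h).
left; apply: div_v => //; apply: nz.
by case: ab => // /vle0 /(_ h).
Qed.

(** A+ is local: one of a and b is outside p, so one divides the other, and the
    divisor then divides a + b = 1. *)
Lemma unit_or_unit a b : a + b = 1 -> divides a (1 : R) \/ divides b (1 : R).
Proof.
move=> ab1.
have : a \notin p \/ b \notin p.
  have [ap|] := boolP (a \in p); [right | by left].
  apply/negP => bp; have : a + b \in (vsupport_ideal v : {pred R}) by apply: rpredD.
  by rewrite ab1 idealr1.
case/divides_total => [[c bc]|[c ac]].
  by left; exists (1 + c); rewrite mulrDr mulr1 -bc.
by right; exists (c + 1); rewrite mulrDr mulr1 -ac.
Qed.

Lemma nonunit_radical s :
  ~ divides s (1 : R) -> forall c, exists e, e * (1 + s * c) = 1.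
Proof.
move=> s_nonunit c.
case: (@unit_or_unit (1 + s * c) (- (s * c))); first by rewrite addrK.
  by case=> e he; exists e; rewrite mulrC.
by case=> e he; case: s_nonunit; exists (- (c * e)); rewrite he; ring.
Qed.

Lemma nontrivial_nonunit :
  nontrivial v -> exists2 s, s \notin p & ~ divides s (1 : R).
Proof.
move=> nontriv; apply: contrapT => no_s; apply: nontriv; split.
  by apply/eqP; exact: oner_neq0.
elim/quotW => x /eqP x_neq0.
have xp : x \notin p.
  apply: contra x_neq0 => xp.
  by rewrite piE Quotient.equivE subr0.
have : divides x 1 by apply: contrapT => nx; apply: no_s; exists x.
case=> y xy; exists (\pi_{ideal_quot vsupport_ideal v} y).
by rewrite -rmorphM -xy rmorph1.
Qed.

Lemma outside_support_cancel s x : s \notin p -> s * x = 0 -> x = 0.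
Proof.
have [zd _] := semi_v => sp sx0; apply: contrapT => x_neq0.
by move/negP: sp; apply; apply: zd; exists x.
Qed.

(** The value 0 of x is at most that of s, so s divides x; the quotient is in p
    because p is prime. *)
Lemma support_divisible s x : s \notin p -> x \in p ->
  exists2 y, y \in p & x = s * y.
Proof.
have [_ div_v] := semi_v => sp xp.
have vx : v x = None by move: xp; rewrite unfold_in => /eqP.
have vs : v s <> None by move: sp; rewrite unfold_in => /eqP.
have [|y xE] := div_v x s _ vs; first by rewrite vx.
exists y => //; move: xp; rewrite xE (prime_idealrM (vsupport_ideal v)).
by rewrite (negPf sp).
Qed.

Hypotheses (nontriv_v : nontrivial v) (cohR : coherent R).

(** The module K of relations satisfies K = sK for a non-unit s outside p: the
    coefficients of a relation are in p, hence divisible by s, and s is not a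
    zero divisor, so the quotients still form a relation. Coherence makes K
    finitely generated, and Nakayama's lemma gives K = 0. *)
Lemma relations_trivial n (x : 'I_n -> R) :
  (forall z : 'rV[R]_n, \sum_i z 0 i * x i = 0 -> forall i, z 0 i \in p) ->
  forall z : 'rV[R]_n, \sum_i z 0 i * x i = 0 -> z = 0.
Proof.
move=> rel_p z rel_z.
have [s sp s_nonunit] := nontrivial_nonunit nontriv_v.
have [k [h hE]] := coherent_relations x cohR.
have hS u : h u \in im h by rewrite unfold_in; apply/asboolP; exists u.
have K0 : forall y : submod (im h), y = 0.
  apply: (nakayama (nonunit_radical s_nonunit)).
    exists k, (corestrict hS) => y.
    have := incl_mem y; rewrite unfold_in => /asboolP[u hu].
    by exists u; apply: val_inj; rewrite -hu.
  move=> y; have := incl_mem y; rewrite unfold_in => /asboolP/hE rel_y.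
  have /choice[c yc] i : exists c, incl _ y 0 i = s * c.
    by have [c _ ->] := support_divisible sp (rel_p _ rel_y i); exists c.
  have yE : incl _ y = s *: \row_i c i by apply/rowP => i; rewrite !mxE yc.
  have /incl_onto[y' y'E] : \row_i c i \in im h.
    rewrite unfold_in; apply/asboolP/hE; apply: (outside_support_cancel sp).
    rewrite mulr_sumr -[RHS]rel_y; apply: eq_bigr => i _.
    by rewrite yE !mxE mulrA.
  by exists y'; apply: val_inj; rewrite [LHS]yE -y'E.
have [w <-] := (hE z).1 rel_z.
by rewrite -(corestrictE hS) (K0 (corestrict hS w)) linear0.
Qed.

(** A relation z a = 0 with a nonzero makes z a zero divisor, so z is in p, and
    the previous lemma applies to the single element a. *)
Lemma semi_valuation_integral : integral R.
Proof.
have [zd _] := semi_v.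
move=> a b ab0; have [->|a_neq0] := pselect (a = 0); [by left | right].
have rel z : \sum_i (z : 'rV[R]_1) 0 i * a = z 0 0 * a by rewrite big_ord1.
have := @relations_trivial 1 (fun=> a) _ (const_mx b).
rewrite rel mxE mulrC => H.
have /rowP/(_ 0) : const_mx b = 0 :> 'rV[R]_1.
  apply: H => // z; rewrite rel => za0 i; rewrite ord1.
  by apply: zd; exists a.
by rewrite !mxE.
Qed.

(** Divisibility in A, stated in A+ by clearing the denominator u. If it failed
    both ways, no relation between a and b could have a coefficient outside p;
    then the Koszul relation (b, -a) would be zero, yet b = 0 is divisible by
    a. *)
Lemma fraction_comparable a b :
  exists2 u, u \notin p & divides a (u * b) \/ divides b (u * a).
Proof.
have one_p : 1 \notin p by rewrite (idealr1 (vsupport_ideal v)).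
apply: contrapT => nab.
have ab z1 z2 : z1 * a + z2 * b = 0 -> z1 \in p /\ z2 \in p.
  move=> rel; split; apply: contrapT => /negP zp; apply: nab.
    exists z1 => //; right; exists (- z2).
    by rewrite -[LHS]subr0 -rel; ring.
  exists z2 => //; left; exists (- z1).
  by rewrite -[LHS]subr0 -rel; ring.
pose x (i : 'I_2) := if i == 0 then a else b.
have relE (z : 'rV[R]_2) : \sum_i z 0 i * x i = z 0 0 * a + z 0 1 * b.
  by rewrite big_ord_recl big_ord1 /x /=; congr (_ + z 0 _ * _); apply: val_inj.
have z0 : \row_(i < 2) (if i == 0 then b else - a) = 0.
  apply: (@relations_trivial 2 x) => [z|]; last by rewrite relE !mxE /=; ring.
  rewrite relE => /ab[z0p z1p] i; case: (unliftP 0 i) => [j ->|->] //.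
  by rewrite ord1 (_ : lift 0 0 = 1) //; apply: val_inj.
have b0 : b = 0 by have /rowP/(_ 0) := z0; rewrite !mxE.
by apply: nab; exists 1 => //; left; exists 0; rewrite b0; ring.
Qed.

Lemma localization_integral : integral (semi_fraction_ring v).
Proof.
elim/locfrac_ind => a s; elim/locfrac_ind => b t.
rewrite locfracM => /locfracP[u]; rewrite mul0r subr0 dval_denom1 mulr1.
move=> /(outside_support_cancel (dvalP u))/semi_valuation_integral.
by case=> ->; [left | right]; apply: locfrac_congr; rewrite !mul0r.
Qed.

Lemma localization_total_divides : total_divides (semi_fraction_ring v).
Proof.
have div_loc a s b t u : u \notin p -> divides a (u * b) ->
    divides (locfrac (I := vsupport_ideal v) a s) (locfrac b t).
  move=> up [c uc].
  pose u' : denom (vsupport_ideal v) := exist _ u up.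
  exists (locfrac (c * dval s) (denomM u' t)).
  rewrite locfracM; apply: locfrac_congr; rewrite !dval_denomM -[dval u']/u.
  have -> : a * (c * dval s) * dval t = (a * c) * (dval s * dval t) by ring.
  by rewrite -uc; ring.
elim/locfrac_ind => a s; elim/locfrac_ind => b t.
have [u up [div|div]] := fraction_comparable a b.
  by left; apply: div_loc div.
by right; apply: div_loc div.
Qed.

End SemiValuationRing.

Theorem lemma3p13 (d : Order.disp_t) (Gamma : orderedAbGroupType d)
    (Aplus : comNzRingType) (v : valuation Aplus Gamma) :
  semi_valuation v -> nontrivial v ->
  coherent (semi_fraction_ring v) -> ~ regular (semi_fraction_ring v) ->
  ~ coherent Aplus.
Proof.
move=> semi_v nontriv_v _ not_regular cohA; apply: not_regular.
apply: valuation_domain_regular.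
  exact: localization_integral semi_v nontriv_v cohA.
exact: localization_total_divides semi_v nontriv_v cohA.
Qed.
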